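(* Let $G$ be a two-connected triangle-free graph with $N$ vertices, and let $p\ge N-1$ be a prime power. If $d_a=p$ for all $a\in[N]$, then $(G,d)$ does not have the interior point property.
   Context: Graphs are finite, simple, undirected, with vertex set $[N]=\{1,\dots,N\}$ for some integer $N>1$. A graph is triangle-free if it does not contain a cycle of length three. A graph is two-connected if it remains connected when a single node is eliminated. Let $d=(d_v)_{v\in[N]}$ with integers $d_v\ge2$, $[m]=\{1,\dots,m\}$, $\mathcal X=\prod_v[d_v]$, $x_W=(x_v)_{v\in W}$. $\mathcal B_{\mathrm{gl}(G)}\subset\mathbb Z^{\mathcal X}$ is the set of all moves $e_{x_Ax_Bx_C}+e_{x'_Ax'_Bx_C}-e_{x_Ax'_Bx_C}-e_{x'_Ax_Bx_C}$ ($e_x$ = unit vectors), where $A,B,C$ range over all partitions $[N]=A\cup B\cup C$ into disjoint (possibly empty) sets such that every path in $G$ from a vertex of $A$ to a vertex of $B$ meets $C$, and $x_A,x'_A,x_B,x'_B,x_C$ range over all states of the respective subsets. $A_G$ is the integer matrix with $(A_Gu)_{W,y}=\sum_{x\in\mathcal X:\,x_W=y}u_x$ for every clique $W$ of $G$ and $y\in\prod_{v\in W}[d_v]$. The fiber of $u\in\mathbb N^{\mathcal X}$ is $\{v\in\mathbb N^{\mathcal X}:A_Gv=A_Gu\}$ ($0\in\mathbb N$). It is connected by $\mathcal B_{\mathrm{gl}(G)}$ if any two of its elements are joined by a finite sequence in $\mathbb N^{\mathcal X}$ whose consecutive differences lie in $\pm\mathcal B_{\mathrm{gl}(G)}$.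 $(G,d)$ has the interior point property if, for every $u\in\mathbb N^{\mathcal X}$ such that $A_Gu$ lies in the relative interior of the cone generated by the columns of $A_G$, the fiber of $u$ is connected by $\mathcal B_{\mathrm{gl}(G)}$.
   Formalization: Two-connected is taken to require more than two vertices; this excludes only the single edge K_2 (N=2), for which A_G is injective, all fibers are singletons, and the claim as literally stated is false. *)

(* Defs.v *)
From HB Require Import structures.
From Stdlib Require Import Relation_Operators.
From mathcomp Require Import all_boot all_order all_algebra.
From mathcomp Require Import all_classical all_reals all_analysis.

Set Implicit Arguments.
Unset Strict Implicit.
Unset Printing Implicit Defensive.

Import Order.TTheory GRing.Theory Num.Theory.
Import numFieldNormedType.Exports.

Local Open Scope ring_scope.

Definition prime_power (p : nat) : Prop :=
  exists q k : nat, [/\ prime q, (0 < k)%N & p = (q ^ k)%N].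

(** ** Graphs: a finite simple graph is a symmetric irreflexive relation. *)

Definition simple_graph (T : finType) (e : rel T) : Prop :=
  symmetric e /\ irreflexive e.

Definition triangle_free (T : finType) (e : rel T) : Prop :=
  forall x y z : T, ~ [/\ e x y, e y z & e z x].

Definition induced_connected (T : finType) (e : rel T) (S : {set T}) : Prop :=
  {in S &, forall x y : T, connect [rel a b in S | e a b] x y}.

(** The bound on the order is the usual convention for k-connectedness (more
    than k vertices); all it excludes on at least two vertices is K_2, which
    would otherwise pass. *)
Definition two_connected (T : finType) (e : rel T) : Prop :=
  [/\ (2 < #|T|)%N,
      induced_connected e [set: T]
    & forall v : T, induced_connected e [set~ v]].

(** The empty set and the singletons are cliques. *)
Definition clique (T : finType) (e : rel T) (W : {set T}) : bool :=
  [forall x in W, forall y in W, (x != y) ==> e x y].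

Definition separates (T : finType) (e : rel T) (A B C : {set T}) : Prop :=
  forall (a : T) (p : seq T), a \in A -> last a p \in B ->
    path e a p -> uniq (a :: p) -> has (mem C) (a :: p).

Definition tripartition (T : finType) (A B C : {set T}) : Prop :=
  [/\ A :|: B :|: C = [set: T],
      [disjoint A & B], [disjoint A & C] & [disjoint B & C]].

(** ** States and global moves *)

Definition state (N : nat) (d : 'I_N -> nat) : finType :=
  {dffun forall v : 'I_N, 'I_(d v)}.

Definition pstate (N : nat) (d : 'I_N -> nat) (W : {set 'I_N}) : finType :=
  {dffun forall v : {v : 'I_N | v \in W}, 'I_(d (val v))}.

Definition restr (N : nat) (d : 'I_N -> nat) (W : {set 'I_N}) (x : state d) :
    pstate d W :=
  [ffun v : {v : 'I_N | v \in W} => x (val v)].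

(** The state x_A x_B x_C for a partition A, B, C of the vertices.  The partial
    states are given by arbitrary full states extending them: only the
    coordinates of xA in A, of xB in B and of xC in C are used. *)
Definition join_states (N : nat) (d : 'I_N -> nat) (A B : {set 'I_N})
    (xA xB xC : state d) : state d :=
  [ffun v : 'I_N => if v \in A then xA v else if v \in B then xB v else xC v].

Definition unit_vec (N : nat) (d : 'I_N -> nat) (x : state d) :
    {ffun state d -> int} :=
  [ffun y => (y == x)%:R].

Local Open Scope classical_set_scope.

Definition global_moves (N : nat) (e : rel 'I_N) (d : 'I_N -> nat) :
    set {ffun state d -> int} :=
  [set z | exists A B C : {set 'I_N},
     [/\ tripartition A B C, separates e A B C
       & exists xA xA' xB xB' xC : state d,
           z = unit_vec (join_states A B xA xB xC) + unit_vec (join_states A B xA' xB' xC)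
             - unit_vec (join_states A B xA xB' xC) - unit_vec (join_states A B xA' xB xC)]].

(** ** The marginal matrix: rows are indexed, through [enum_val], by pairs
    (W, y) with W a clique and y a state of W, columns by full states. *)

Definition margin (N : nat) (e : rel 'I_N) (d : 'I_N -> nat) : finType :=
  {W : {W : {set 'I_N} | clique e W} & pstate d (val W)}.

Definition marginal_mx (N : nat) (e : rel 'I_N) (d : 'I_N -> nat) :
    'M[int]_(#|margin e d|, #|state d|) :=
  \matrix_(i, j)
    (restr (val (tag (enum_val i))) (enum_val j) == tagged (enum_val i))%:R.

Definition col_of (N : nat) (d : 'I_N -> nat) (u : {ffun state d -> nat}) :
    'cV[int]_#|state d| :=
  \col_j (u (enum_val j))%:Z.

Definition fiber (N : nat) (e : rel 'I_N) (d : 'I_N -> nat)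
    (u : {ffun state d -> nat}) : set {ffun state d -> nat} :=
  [set v | marginal_mx e d *m col_of v = marginal_mx e d *m col_of u].

Definition diff_vec (N : nat) (d : 'I_N -> nat) (v w : {ffun state d -> nat}) :
    {ffun state d -> int} :=
  [ffun x => (w x)%:Z - (v x)%:Z].

Definition move_step (N : nat) (e : rel 'I_N) (d : 'I_N -> nat)
    (v w : {ffun state d -> nat}) : Prop :=
  global_moves e (diff_vec v w) \/ global_moves e (- diff_vec v w).

Definition fiber_connected (N : nat) (e : rel 'I_N) (d : 'I_N -> nat)
    (u : {ffun state d -> nat}) : Prop :=
  forall v w : {ffun state d -> nat}, fiber e u v -> fiber e u w ->
    clos_refl_trans _ (@move_step N e d) v w.

(** ** Relative interior of the cone of margins *)

Definition cone_of_columns (R : realType) (m n : nat) (A : 'M[R]_(m, n)) :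
    set 'cV[R]_m :=
  [set A *m c | c in [set c : 'cV[R]_n | forall j, 0 <= c j 0]].

Definition affine_hull (R : realType) (V : lmodType R) (S : set V) : set V :=
  [set y | exists (n : nat) (a : 'I_n -> R) (s : 'I_n -> V),
     [/\ forall i, S (s i), \sum_(i < n) a i = 1
       & y = \sum_(i < n) a i *: s i]].

Definition relative_interior (R : realType) (m : nat) (S : set 'cV[R]_m) :
    set 'cV[R]_m :=
  [set x | S x /\ \forall y \near x, affine_hull S y -> S y].

Definition interior_point_property (R : realType) (N : nat) (e : rel 'I_N)
    (d : 'I_N -> nat) : Prop :=
  forall u : {ffun state d -> nat},
    relative_interior (cone_of_columns (map_mx intr (marginal_mx e d)))
      (map_mx intr (marginal_mx e d *m col_of u) : 'cV[R]_#|margin e d|) ->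
    fiber_connected e u.

(* Main.v *)
(** Since [G] has no triangles, cliques have at most two vertices.  Take an MDS
    code [S] of length [N] and dimension 2 over the field with [p] elements: any
    two symbols of a codeword are arbitrary and determine it.  All edge margins
    of the indicator [u] of [S] are 1, so every code of this kind has the margin
    of [u]; averaging such codes shows that this margin is interior.  A move
    applicable to [u] involves two codewords that agree on the separator [C].  If
    [#|C| >= 2] they coincide, and if [#|C| <= 1] two-connectedness forces one
    side to be empty; either way the move is zero.  Hence [u] is isolated in its
    fiber, which contains the other codes as well. *)

Require Import Defs.
From Stdlib Require Import Relation_Operators.
From mathcomp Require Import all_boot all_order all_algebra all_field.
From mathcomp Require Import perm.
From mathcomp Require Import all_classical all_reals all_analysis.

Set Implicit Arguments.
Unset Strict Implicit.
Unset Printing Implicit Defensive.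

Import Order.TTheory GRing.Theory Num.Theory.
Import numFieldNormedType.Exports.

Local Open Scope ring_scope.

(** * Relative interior of a finitely generated cone *)

(** A nearby point of the affine hull lifts through a generalized inverse of [A] to a small
    correction of [c], too small to make any coefficient negative. *)
Lemma relative_interior_cone (R : realType) (m n : nat) (A : 'M[R]_(m, n))
    (c : 'cV[R]_n) (r : R) :
  0 < r -> (forall j, r <= c j 0) ->
  relative_interior (cone_of_columns A) (A *m c).
Proof.
move=> r0 hc; split.
  by exists c => // j; apply: le_trans (hc j); apply: ltW.
have [B ABA] : exists B, A *m B *m A = A.
  by exists (pinvmx A); apply: mulmxKpV; apply: submx_refl.
(* [K] bounds every absolute row sum of [B], so a perturbation below [r / K] changes each
   coefficient by at most [r]; the summand 1 keeps [K] positive. *)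
pose K : R := 1 + \sum_j \sum_i `|B j i|.
have sum0 : 0 <= \sum_j \sum_i `|B j i|.
  by apply: sumr_ge0 => j _; apply: sumr_ge0.
have K0 : 0 < K by rewrite /K ltr_wpDr.
apply/nbhs_ballP; exists (r / K) => /=; first exact: divr_gt0.
move=> y [_ yball] [k [a [s [hs _ yE]]]].
have [t yt] : exists t, y = A *m t.
  have hs' i : exists t, A *m t = s i by have [t _ <-] := hs i; exists t.
  have [t tE] := choice hs'.
  exists (\sum_i a i *: t i); rewrite yE mulmx_sumr.
  by apply: eq_bigr => i _; rewrite -scalemxAr tE.
rewrite {}yt in yball *; exists (c + B *m (A *m t - A *m c)) => [j|]; last first.
  by rewrite -mulmxBr mulmxDr !mulmxA ABA mulmxBr addrC subrK.
rewrite !mxE -lerBlDl sub0r lerNnormlW // (le_trans _ (hc j)) //.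
rewrite (le_trans (ler_norm_sum _ _ _)) //.
have -> : r = \sum_j \sum_i `|B j i| * (r / K) + r / K.
  under eq_bigr do rewrite -mulr_suml.
  by rewrite -mulr_suml -[X in _ + X]mul1r -mulrDl addrC mulrC divfK // gt_eqF.
apply: ler_wpDr; first by rewrite divr_ge0 ?ltW.
rewrite (bigD1 j) //= ler_wpDr //.
  apply: sumr_ge0 => j' _; apply: sumr_ge0 => i _.
  by apply: mulr_ge0 => //; apply: divr_ge0; apply: ltW.
apply: ler_sum => i _; rewrite normrM ler_wpM2l //.
by have := yball i 0; rewrite /ball /= !mxE distrC => /ltW.
Qed.

(** * Moves at a code *)

Lemma separates_small_trivial (T : finType) (e : rel T) (A B C : {set T}) :
  two_connected e -> tripartition A B C -> separates e A B C ->
  (#|C| <= 1)%N -> A = finset.set0 \/ B = finset.set0.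
Proof.
move=> [_ conT conD] [_ _ dAC dBC] sep C1.
have [->|[a aA]] := finset.set_0Vmem A; first by left.
have [->|[b bB]] := finset.set_0Vmem B; first by right.
have conC : induced_connected e (~: C).
  case: (posnP #|C|) => [/eqP|C0].
    by rewrite cards_eq0 => /eqP ->; rewrite finset.setC0.
  have /eqP/cards1P[c ->] : #|C| = 1%N by apply/eqP; rewrite eqn_leq C1.
  exact: conD.
have aC : a \in ~: C by rewrite inE (disjointFr dAC).
have bC : b \in ~: C by rewrite inE (disjointFr dBC).
(* [separates] only speaks of duplicate-free paths, so the walk is shortened first. *)
have /connectP[q /shortenP[q' q'path q'uniq _] bE] := conC a b aC bC.
have q'C : all (mem (~: C)) q'.
  elim: q' (a) q'path {bE q'uniq} => //= y q' IH z /andP[/andP[/andP[_ yC] _]].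
  by rewrite yC; exact: IH.
have /(sep a q' aA) : last a q' \in B by rewrite -bE.
have /[swap]/[apply] : path e a q'.
  by apply: sub_path q'path => x y /andP[].
move=> /(_ q'uniq) /= /orP[|/hasP[x /(allP q'C)]]; last by rewrite !inE => /negP.
by move: aC; rewrite !inE => /negP.
Qed.

(** Exchanging [xB] and [xB'] swaps the added states with the subtracted ones. *)
Lemma global_movesN (N : nat) (e : rel 'I_N) (d : 'I_N -> nat)
    (z : {ffun state d -> int}) :
  global_moves e (- z) -> global_moves e z.
Proof.
move=> [A [B [C [tri sep [xA [xA' [xB [xB' [xC zE]]]]]]]]].
exists A, B, C; split=> //; exists xA, xA', xB', xB, xC.
by rewrite -[LHS]opprK zE !opprD !opprK -addrA addrC addrA.
Qed.

Definition indicator (N : nat) (d : 'I_N -> nat) (S : {set state d}) :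
  {ffun state d -> nat} := [ffun x => nat_of_bool (x \in S)].

(** Minimum distance at least [N - 1], the separation half of the MDS condition. *)
Definition pairwise_determined (N : nat) (d : 'I_N -> nat)
    (S : {set state d}) : Prop :=
  forall v w : 'I_N, v != w ->
    {in S &, forall x y : state d, x v = y v -> x w = y w -> x = y}.

Lemma indicator_isolated (N : nat) (e : rel 'I_N) (d : 'I_N -> nat)
    (S : {set state d}) (w : {ffun state d -> nat}) :
  two_connected e -> pairwise_determined S ->
  move_step e (indicator S) w -> w = indicator S.
Proof.
move=> h2c hS hstep.
have {hstep} : global_moves e (diff_vec (indicator S) w).
  by case: hstep => // /global_movesN.
move=> [A [B [C [tri sep [xA [xA' [xB [xB' [xC zE]]]]]]]]].
have dAB : [disjoint A & B] by case: tri.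
pose j := @join_states N d A B.
pose z : {ffun state d -> int} := unit_vec (j xA xB xC) + unit_vec (j xA' xB' xC)
  - unit_vec (j xA xB' xC) - unit_vec (j xA' xB xC).
rewrite -/j -/z in zE.
have zx x : (w x)%:Z - (x \in S)%:Z = z x by rewrite -zE !ffunE.
suff z0 : z = 0.
  apply/ffunP => x; have /eqP := zx x.
  by rewrite z0 !ffunE subr_eq0 => /eqP [].
have jA xA1 xB1 xA2 xB2 v : v \in A -> j xA1 xB1 xC = j xA2 xB2 xC -> xA1 v = xA2 v.
  by move=> vA /(congr1 (fun f : state d => f v)); rewrite !ffunE vA.
have jB xA1 xB1 xA2 xB2 v : v \in B -> j xA1 xB1 xC = j xA2 xB2 xC -> xB1 v = xB2 v.
  by move=> vB /(congr1 (fun f : state d => f v)); rewrite !ffunE vB (disjointFl dAB vB).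
(* The move vanishes once its two states agree on one side; every case below ends in [zA] or
   [zB]. *)
have zA : {in A, forall v, xA v = xA' v} -> z = 0.
  move=> h; rewrite /z.
  have E xB1 : j xA xB1 xC = j xA' xB1 xC.
    by apply/ffunP => v; rewrite !ffunE; case: ifP => // /h.
  by rewrite !E addrK subrr.
have zB : {in B, forall v, xB v = xB' v} -> z = 0.
  move=> h; rewrite /z.
  have E xA1 : j xA1 xB xC = j xA1 xB' xC.
    by apply/ffunP => v; rewrite !ffunE; case: ifP => // _; case: ifP => // /h.
  by rewrite !E addrAC addrK subrr.
have [C1|C2] := leqP #|C| 1.
  by have [E|E] := separates_small_trivial h2c tri sep C1;
    [apply: zA|apply: zB] => v; rewrite E inE.
have nonneg x : 0 <= (x \in S)%:Z + z x.
  by rewrite -zx addrC subrK.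
(* A move cannot decrease an entry that is zero. *)
have x3 : [|| j xA xB' xC \in S, j xA xB' xC == j xA xB xC
             | j xA xB' xC == j xA' xB' xC].
  have := nonneg (j xA xB' xC); rewrite !ffunE eqxx.
  by do 3!case: (_ == _); case: (_ \in _).
have x4 : [|| j xA' xB xC \in S, j xA' xB xC == j xA xB xC
             | j xA' xB xC == j xA' xB' xC].
  have := nonneg (j xA' xB xC); rewrite !ffunE eqxx.
  by do 3!case: (_ == _); case: (_ \in _).
(* A subtracted state that cancels against an added one shares one side with it, so the other side
   must agree. *)
case/or3P: x3 => [x3|/eqP E|/eqP E]; last 2 first.
- by apply: zB => v vB; apply/esym/(jB _ _ _ _ _ vB E).
- by apply: zA => v vA; apply: (jA _ _ _ _ _ vA E).
case/or3P: x4 => [x4|/eqP E|/eqP E]; last 2 first.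
- by apply: zA => v vA; apply/esym/(jA _ _ _ _ _ vA E).
- by apply: zB => v vB; apply: (jB _ _ _ _ _ vB E).
(* Now both subtracted states are codewords, and they share the two symbols at [a] and [b]. *)
have /card_gt1P[a [b [aC bC ab]]] := C2.
have jC c xA1 xB1 xA2 xB2 : c \in C -> j xA1 xB1 xC c = j xA2 xB2 xC c.
  move=> cC; case: tri => _ _ dAC dBC.
  by rewrite !ffunE (disjointFl dAC cC) (disjointFl dBC cC).
have E := hS a b ab _ _ x3 x4 (jC _ _ _ _ _ aC) (jC _ _ _ _ _ bC).
by apply: zA => v vA; apply: (jA _ _ _ _ _ vA E).
Qed.

Lemma clos_refl_trans_isolated (T : Type) (r : T -> T -> Prop) (x y : T) :
  (forall z, r x z -> z = x) -> clos_refl_trans T r x y -> y = x.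
Proof.
move=> iso rxy; suff gen a b : clos_refl_trans T r a b -> a = x -> b = x.
  exact: gen rxy _.
elim=> [{}a {}b + aE|//|{}a {}b c _ IHab _ IHbc aE]; last exact/IHbc/IHab.
by rewrite aE; apply: iso.
Qed.

(** * Orthogonal arrays and their margins *)

(** Strength two and index one: an MDS code of dimension 2, with no linearity required. *)
Definition orthogonal_array (N p : nat) (S : {set state (fun _ : 'I_N => p)}) :
    Prop :=
  pairwise_determined S /\
  forall v w : 'I_N, v != w -> forall s t : 'I_p,
    exists2 x, x \in S & x v = s /\ x w = t.

Lemma marginal_mx_mulE (N : nat) (e : rel 'I_N) (d : 'I_N -> nat)
    (u : {ffun state d -> nat}) i :
  (marginal_mx e d *m col_of u) i 0 =
  \sum_x (restr (val (tag (enum_val i))) x == tagged (enum_val i))%:R * (u x)%:Z.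
Proof.
rewrite mxE [RHS](big_enum_val (A := state d)).
by apply: eq_bigr => k _; rewrite !mxE.
Qed.

(** Padding smaller cliques to a pair lets the empty, singleton and edge margins be treated
    alike. *)
Lemma clique_triangle_free (T : finType) (e : rel T) (W : {set T}) :
  (1 < #|T|)%N -> symmetric e -> triangle_free e -> clique e W ->
  exists v w : T, v != w /\ W \subset [set v; w].
Proof.
move=> T1 esym tf Wcl.
have W2 : (#|W| <= 2)%N.
  rewrite leqNgt; apply/negP => /card_gt2P[x [y [z [[xW yW zW] [xy yz zx]]]]].
  have E a b : a \in W -> b \in W -> a != b -> e a b.
    move=> aW bW ab.
    by move/forall_inP/(_ a aW)/forall_inP/(_ b bW)/implyP/(_ ab): Wcl.
  by apply: (tf x y z); split; apply: E.
have [v [w [_ _ vw]]] : exists v w : T, [/\ v \in T, w \in T & v != w].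
  exact/card_gt1P.
case: (leqP #|W| 1) => [W1|W1]; last first.
  have /cards2P[x [y [xy ->]]] : #|W| == 2 by rewrite eqn_leq W2.
  by exists x, y.
have [->|[x xW]] := finset.set_0Vmem W; first by exists v, w; rewrite finset.sub0set.
have WE : W \subset [set x].
  by apply/fintype.subsetP => y yW; rewrite inE; apply/eqP/(card_le1_eqP W1).
have [y xy] : exists y, x != y.
  have [->|xv] := eqVneq x v; first by exists w.
  by exists v.
by exists x, y; split=> //; apply: fintype.subset_trans WE _; apply: finset.subsetUl.
Qed.

(** Reading off [v] and [w] is a bijection from the array onto pairs of symbols, which turns a
    margin into a sum that no longer mentions the array. *)
Lemma orthogonal_array_margin (N p : nat) (e : rel 'I_N)
    (S S' : {set state (fun _ : 'I_N => p)}) :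
  (1 < N)%N -> symmetric e -> triangle_free e ->
  orthogonal_array S -> orthogonal_array S' ->
  marginal_mx e _ *m col_of (indicator S) =
  marginal_mx e _ *m col_of (indicator S').
Proof.
move=> N1 esym tf hS hS'; apply/matrixP => i k; rewrite ord1 {k}.
rewrite !marginal_mx_mulE; case: (enum_val i) => -[W /= Wcl] y /=.
have [|v [w [vw Wvw]]] := clique_triangle_free _ esym tf Wcl.
  by rewrite card_ord.
(* Only the coordinates in [W], hence at [v] and [w], matter; [q.2] is a filler elsewhere. *)
pose g (q : 'I_p * 'I_p) : int :=
  (restr W ([ffun v' => if v' == v then q.1 else q.2] :
    state (fun _ : 'I_N => p)) == y)%:R.
suff main (X : {set state (fun _ : 'I_N => p)}) : orthogonal_array X ->
    \sum_x (restr W x == y)%:R * (indicator X x)%:Z = \sum_q g q.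
  by rewrite !main.
move=> [Xinj Xsurj]; pose h (x : state (fun _ : 'I_N => p)) := (x v, x w).
rewrite (bigID (mem X)) /= [X in _ + X]big1 ?addr0 => [|x /negbTE xX]; last first.
  by rewrite ffunE xX mulr0.
have hX : [set h x | x in X] = [set: 'I_p * 'I_p].
  apply/setP => -[s t]; rewrite inE; apply/imsetP.
  by have [x xX [xs xt]] := Xsurj v w vw s t; exists x => //; rewrite /h xs xt.
transitivity (\sum_(q in [set h x | x in X]) g q); last first.
  by rewrite hX; apply: eq_bigl => q; rewrite inE.
rewrite big_imset /= => [|x x' xX x'X [xv xw]]; last exact: (Xinj v w).
apply: eq_bigr => x xX; rewrite ffunE xX mulr1 /g; congr (_ == _)%:R.
apply/ffunP => -[v' v'W]; rewrite !ffunE /=.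
have := fintype.subsetP Wvw _ v'W; rewrite !inE.
by case: eqVneq => [->//|_ /= /eqP ->].
Qed.

Definition permute_symbols (N p : nat) (f : 'I_N -> {perm 'I_p})
    (x : state (fun _ : 'I_N => p)) : state (fun _ : 'I_N => p) :=
  [ffun v => f v (x v)].

Lemma orthogonal_array_permute (N p : nat) (S : {set state (fun _ : 'I_N => p)})
    (f : 'I_N -> {perm 'I_p}) :
  orthogonal_array S -> orthogonal_array [set permute_symbols f x | x in S].
Proof.
move=> [Sinj Ssurj]; split=> [v w vw _ _ /imsetP[x xS ->] /imsetP[y yS ->]|].
  rewrite !ffunE => /perm_inj xv /perm_inj xw.
  by congr permute_symbols; apply: (Sinj v w).
move=> v w vw s t.
have [x xS [xs xt]] := Ssurj v w vw ((f v)^-1%g s) ((f w)^-1%g t).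
exists (permute_symbols f x); first exact: imset_f.
by rewrite !ffunE xs xt !permKV.
Qed.

(** Transposing [x v] with [z v] in each coordinate [v] carries [x] to [z]. *)
Lemma orthogonal_array_through (N p : nat) (S : {set state (fun _ : 'I_N => p)})
    (x z : state (fun _ : 'I_N => p)) :
  orthogonal_array S -> x \in S -> exists2 S', orthogonal_array S' & z \in S'.
Proof.
move=> hS xS.
exists [set permute_symbols (fun v => tperm (x v) (z v)) y | y in S].
  exact: orthogonal_array_permute.
apply/imsetP; exists x => //.
by apply/ffunP => v; rewrite ffunE tpermL.
Qed.

(* The extended Reed-Solomon code of dimension 2: the words
   [(a + b t)_t] for [t] in the field, completed at infinity by [b]. *)
Lemma orthogonal_array_exists (F : finFieldType) (N : nat) :
  (N <= #|F|.+1)%N ->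
  exists S : {set state (fun _ : 'I_N => #|F|)}, orthogonal_array S.
Proof.
(* [None] serves as the point at infinity, which allows one position more than the field has
   elements. *)
move=> NF; have NF' : (N <= #|{: option F}|)%N by rewrite card_option.
pose al (v : 'I_N) : option F := enum_val (widen_ord NF' v).
have al_inj : injective al.
  by move=> v w /enum_val_inj /(congr1 val) /= /val_inj.
pose c (q : F * F) (v : 'I_N) : F :=
  if al v is Some t then q.1 + q.2 * t else q.2.
have c_inj v w q q' : v != w -> c q v = c q' v -> c q w = c q' w -> q = q'.
  rewrite -(inj_eq al_inj) /c; case: q q' => [a b] [a' b'] /=.
  case: (al v) (al w) => [s|] [t|] //= st.
  - move=> Es Et.
    have E : (b - b') * (s - t) = 0.
      have := congr2 (fun x y => x - y) Es Et.
      rewrite /= !opprD (addrACA a) (addrACA a') !subrr !add0r -!mulrBr.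
      by rewrite mulrBl => ->; rewrite subrr.
    move/eqP: E; rewrite mulf_eq0 !subr_eq0 => /orP[/eqP bb|/eqP sE].
      by move: Es; rewrite bb => /addIr ->.
    by rewrite sE eqxx in st.
  - by move=> + bb; rewrite bb => /addIr ->.
  - by move=> bb; rewrite bb => /addIr ->.
pose word q : state (fun _ : 'I_N => #|F|) := [ffun v => enum_rank (c q v)].
exists [set word q | q : F * F]; split=> [v w vw|v w vw s t].
  move=> _ _ /imsetP[q _ ->] /imsetP[q' _ ->]; rewrite !ffunE.
  by move=> /enum_rank_inj cv /enum_rank_inj cw; rewrite (c_inj v w q q').
(* An injective self-map of the finite set [F * F] is onto, so all symbol pairs occur. *)
have h_inj : injective (fun q => (c q v, c q w)).
  by move=> q q' [cv cw]; apply: (c_inj v w).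
have [g _ gK] := injF_bij h_inj.
have := gK (enum_val s, enum_val t); set q := g _ => -[cs ct].
exists (word q); first exact: imset_f.
by rewrite !ffunE cs ct !enum_valK.
Qed.

(** * Interiority of the margin and the conclusion *)

Lemma orthogonal_array_interior (R : realType) (N p : nat) (e : rel 'I_N)
    (S : {set state (fun _ : 'I_N => p)}) (x : state (fun _ : 'I_N => p)) :
  (1 < N)%N -> symmetric e -> triangle_free e ->
  orthogonal_array S -> x \in S ->
  relative_interior (cone_of_columns (map_mx intr (marginal_mx e _)))
    (map_mx intr (marginal_mx e _ *m col_of (indicator S)) : 'cV[R]_#|margin e _|).
Proof.
move=> N1 esym tf hS xS.
have hz (z : state (fun _ : 'I_N => p)) : exists S', orthogonal_array S' /\ z \in S'.
  by have [S' ? ?] := orthogonal_array_through z hS xS; exists S'.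
have {hz} [Sz hSz] := choice hz.
(* Averaging arrays that cover all states gives positive weights with the
   same margins. *)
pose M : R := #|state (fun _ : 'I_N => p)|%:R.
have M0 : 0 < M by rewrite ltr0n; apply/card_gt0P; exists x.
pose c : 'cV[R]_#|state (fun _ : 'I_N => p)| :=
  M^-1 *: \sum_z map_mx intr (col_of (indicator (Sz z))).
have -> : map_mx intr (marginal_mx e _ *m col_of (indicator S)) =
    map_mx intr (marginal_mx e _) *m c.
  rewrite -scalemxAr mulmx_sumr.
  rewrite (eq_bigr (fun=>
      map_mx intr (marginal_mx e _ *m col_of (indicator S)))).
    by rewrite sumr_const -scaler_nat scalerA mulVf ?scale1r // gt_eqF.
  move=> z _; rewrite -map_mxM; congr map_mx.
  exact: orthogonal_array_margin (hSz z).1 hS.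
apply: (@relative_interior_cone _ _ _ _ _ M^-1); first by rewrite invr_gt0.
(* The array chosen for the [k]-th state contains it and contributes 1; the other terms are
   nonnegative. *)
move=> k; rewrite mxE summxE ler_pMr ?invr_gt0 // (bigD1 (enum_val k)) //=.
rewrite !mxE ffunE (hSz _).2 ler_wpDr // sumr_ge0 // => z _.
by rewrite !mxE ler0n.
Qed.

Theorem theorem4p10 (R : realType) (N : nat) (e : rel 'I_N)
    (d : 'I_N -> nat) (p : nat) (hN : (1 < N)%N)
    (hG : simple_graph e) (h2c : two_connected e) (htf : triangle_free e)
    (hp : prime_power p) (hpN : (N - 1 <= p)%N)
    (hd : forall a : 'I_N, d a = p) :
  ~ interior_point_property R e d.
Proof.
have dE : d = fun=> p by apply/funext.
subst d => {hd} ipp.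
have [q [k [q_pr k0 pE]]] := hp.
have [F _ FE] := pPrimePowerField q_pr k0.
have pF : p = #|F| by rewrite pE FE.
move: ipp hpN; clear hp pE; subst p => ipp hpN.
have [|S hS] := @orthogonal_array_exists F N; first by rewrite -add1n -leq_subLR.
have /card_gt2P[v1 [v2 [v3 [_ [v12 v23 v31]]]]] : (2 < #|'I_N|)%N by case: h2c.
have [x xS _] := hS.2 v1 v2 v12 (enum_rank 0) (enum_rank 0).
(* Adding 1 in the field alters the symbol at [v3] only; agreeing with [x] at [v1] and [v2], the
   result cannot be a codeword of [S]. *)
pose z : state (fun _ : 'I_N => #|F|) :=
  [ffun v => if v == v3 then enum_rank (enum_val (x v3) + 1) else x v].
have zS : z \notin S.
  apply/negP => zS.
  have zx : z = x.
    apply: (hS.1 v1 v2 v12) => //; first by rewrite ffunE eq_sym (negbTE v31).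
    by rewrite ffunE (negbTE v23).
  have := congr1 (fun f : state _ => enum_val (f v3)) zx.
  rewrite /= ffunE eqxx enum_rankK => /eqP.
  by rewrite -subr_eq0 addrAC subrr add0r oner_eq0.
have [S' hS' zS'] := orthogonal_array_through z hS xS.
have esym : symmetric e := hG.1.
have hI := orthogonal_array_interior R hN esym htf hS xS.
have conn : clos_refl_trans _ (@move_step N e _) (indicator S) (indicator S').
  by apply: (ipp _ hI) => //; apply: orthogonal_array_margin.
have := clos_refl_trans_isolated (fun w => indicator_isolated h2c hS.1) conn.
by move=> /(congr1 (fun f : {ffun state _ -> nat} => f z)); rewrite !ffunE zS' (negbTE zS).
Qed.
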